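(* Let $G$ be a triangle-free graph of even order which is not odd (i.e. some vertex of $G$ has even degree). Then the complement $\overline{G}$ has an odd spanning tree if and only if $G$ is not isomorphic to $C_5(2)$ and $G$ is not isomorphic to $K_{2s,2t}$ or to $K_{2s,2t}-e$ for any positive integers $s,t$.
   Context: All graphs are finite and simple. The complement $\overline{G}$ has vertex set $V(G)$, two vertices being adjacent in $\overline{G}$ iff they are not adjacent in $G$. An odd spanning tree is a spanning tree in which every vertex has odd degree. $C_5(k)$ is the graph obtained from the $5$-cycle $C_5$ by replacing one vertex $v$ with an independent set of $k$ vertices, each adjacent to both neighbours of $v$ in $C_5$ (so $C_5(2)$ has $6$ vertices). $K_{2s,2t}-e$ denotes the graph obtained from the complete bipartite graph $K_{2s,2t}$ by deleting one edge. *)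

(* Defs.v *)
From mathcomp Require Import all_boot.

Set Implicit Arguments.
Unset Strict Implicit.
Unset Printing Implicit Defensive.

Record sgraph (V : finType) := SGraph {
  adj : rel V;
  adj_sym : symmetric adj;
  adj_irrefl : irreflexive adj
}.

Section Graphs.
Variable V : finType.
Implicit Types G H : sgraph V.

Definition degree G (x : V) : nat := #|[set y | adj G x y]|.

Definition odd_graph G : bool := [forall x, odd (degree G x)].

Definition triangle_free G : Prop :=
  forall x y z, adj G x y -> adj G y z -> ~~ adj G x z.

Definition connected G : Prop :=
  0 < #|V| /\ forall x y, connect (adj G) x y.

(* [ucycle] alone also admits [:: x; y] for an edge xy, hence the size bound. *)
Definition acyclic G : Prop :=
  forall c : seq V, 2 < size c -> ~ ucycle (adj G) c.

Definition is_tree G : Prop := connected G /\ acyclic G.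

(* A spanning subgraph of G is a graph on the same vertex type whose edges
   are edges of G. *)
Definition spanning_tree G H : Prop :=
  subrel (adj H) (adj G) /\ is_tree H.

Definition has_odd_spanning_tree G : Prop :=
  exists H : sgraph V, spanning_tree G H /\ odd_graph H.

Definition compl_adj G : rel V := fun x y => (x != y) && ~~ adj G x y.

Fact compl_adj_sym G : symmetric (compl_adj G).
Proof. by move=> x y; rewrite /compl_adj eq_sym adj_sym. Qed.

Fact compl_adj_irrefl G : irreflexive (compl_adj G).
Proof. by move=> x; rewrite /compl_adj eqxx. Qed.

Definition compl G : sgraph V :=
  SGraph (compl_adj_sym G) (compl_adj_irrefl G).

Definition del_adj G (a b : V) : rel V := fun x y =>
  adj G x y && ~~ ((x == a) && (y == b) || (x == b) && (y == a)).

Fact del_adj_sym G a b : symmetric (del_adj G a b).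
Proof.
move=> x y; rewrite /del_adj adj_sym orbC.
by rewrite [(x == b) && _]andbC [(x == a) && _]andbC.
Qed.

Fact del_adj_irrefl G a b : irreflexive (del_adj G a b).
Proof. by move=> x; rewrite /del_adj adj_irrefl. Qed.

Definition del_edge G a b : sgraph V :=
  SGraph (del_adj_sym G a b) (del_adj_irrefl G a b).

(* The vertex v of G is replaced by an independent set of k vertices, each
   adjacent to all the neighbours of v. *)
Definition blowup_adj G (v : V) (k : nat) : rel ({x : V | x != v} + 'I_k) :=
  fun p q => match p, q with
  | inl x, inl y => adj G (val x) (val y)
  | inl x, inr _ => adj G (val x) v
  | inr _, inl y => adj G v (val y)
  | inr _, inr _ => false
  end.

Fact blowup_adj_sym G v k : symmetric (@blowup_adj G v k).
Proof. by move=> [x|i] [y|j] //=; rewrite adj_sym. Qed.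

Fact blowup_adj_irrefl G v k : irreflexive (@blowup_adj G v k).
Proof. by move=> [x|i] //=; rewrite adj_irrefl. Qed.

Definition blowup G v k : sgraph ({x : V | x != v} + 'I_k)%type :=
  SGraph (@blowup_adj_sym G v k) (@blowup_adj_irrefl G v k).

End Graphs.

Definition isomorphic (V W : finType) (G : sgraph V) (H : sgraph W) : Prop :=
  exists f : V -> W,
    bijective f /\ forall x y, adj H (f x) (f y) = adj G x y.

Definition C5_adj : rel 'I_5 := fun i j =>
  (j == i.+1 %[mod 5]) || (i == j.+1 %[mod 5]).

Fact C5_adj_sym : symmetric C5_adj.
Proof. by move=> i j; rewrite /C5_adj orbC. Qed.

Fact C5_adj_irrefl : irreflexive C5_adj.
Proof. by case; do 5 case=> //. Qed.

Definition C5 : sgraph 'I_5 := SGraph C5_adj_sym C5_adj_irrefl.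

Definition C5_blowup (k : nat) := blowup C5 ord0 k.

Definition Kmn_adj (m n : nat) : rel ('I_m + 'I_n) := fun p q =>
  match p, q with
  | inl _, inr _ | inr _, inl _ => true
  | _, _ => false
  end.

Fact Kmn_adj_sym m n : symmetric (@Kmn_adj m n).
Proof. by move=> [x|x] [y|y]. Qed.

Fact Kmn_adj_irrefl m n : irreflexive (@Kmn_adj m n).
Proof. by case. Qed.

Definition Kmn (m n : nat) : sgraph ('I_m + 'I_n)%type :=
  SGraph (@Kmn_adj_sym m n) (@Kmn_adj_irrefl m n).

Definition isomorphic_del_edge (V W : finType)
    (G : sgraph V) (H : sgraph W) : Prop :=
  exists a b : W, adj H a b /\ isomorphic G (del_edge H a b).

(* Main.v *)
Require Import Defs.
From mathcomp Require Import all_boot.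

Set Implicit Arguments.
Unset Strict Implicit.
Unset Printing Implicit Defensive.

(** Work in the complement H of G, whose independent sets have size at most 2,
    and start from a vertex x of even degree in G, with neighbourhood A (an even
    clique of H). The star of H at x spans the even set V \ A with odd degrees.
    If a vertex b outside A has two H-neighbours in A, then A is hung from b as a
    leaf and a star, both of odd order. Otherwise every vertex outside A misses
    at most one vertex of A. If V \ A is independent in G, then G is K_{2s,2t}
    minus some edges: two missing edges give an odd spanning tree, and fewer give
    an exceptional graph. If V \ A contains an edge of G, its ends have no common
    neighbour, so |A| = 2 and G is a C_5 with two fixed vertices and three others
    blown up (some edges possibly missing); this has an odd tree except for C_5(2).
    Conversely, in an odd graph an even set of vertices has an even edge boundary,
    which excludes a single edge joining the two even cliques of H. *)

(** * Adding a pendant edge *)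

Section Pendant.
Variables (V : finType) (T : sgraph V) (x y : V).
Hypothesis xDy : x != y.

Definition add_edge_adj : rel V := fun u v =>
  adj T u v || ((u == x) && (v == y) || (u == y) && (v == x)).

Fact add_edge_sym : symmetric add_edge_adj.
Proof.
move=> u v; rewrite /add_edge_adj adj_sym; congr (_ || _).
by rewrite orbC [(v == y) && _]andbC [(v == x) && _]andbC.
Qed.

Fact add_edge_irrefl : irreflexive add_edge_adj.
Proof.
move=> u; rewrite /add_edge_adj adj_irrefl /=.
case: (u =P x) => [->|_]; last by rewrite andbF.
by rewrite (negbTE xDy).
Qed.

Definition add_edge : sgraph V := SGraph add_edge_sym add_edge_irrefl.

Lemma degree_add_edge z : ~~ adj T x y ->
  degree add_edge z = degree T z + (z == x) + (z == y).
Proof.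
move=> nxy; rewrite /degree.
case: (eqVneq z x) => [->|zx].
  rewrite (negbTE xDy) addn0.
  have -> : [set w | adj add_edge x w] = y |: [set w | adj T x w].
    apply/setP=> w; rewrite !inE /= /add_edge_adj eqxx (negbTE xDy) /= orbF.
    by rewrite orbC.
  by rewrite cardsU1 inE nxy addnC.
case: (eqVneq z y) => [->|zy].
  have -> : [set w | adj add_edge y w] = x |: [set w | adj T y w].
    apply/setP=> w; rewrite !inE /= /add_edge_adj eqxx eq_sym (negbTE xDy) /=.
    by rewrite orbC.
  by rewrite cardsU1 inE adj_sym nxy addn0 addnC.
rewrite !addn0; apply: eq_card => w.
by rewrite !inE /= /add_edge_adj (negbTE zx) (negbTE zy) /= orbF.
Qed.

Lemma acyclic_add_pendant : (forall u, ~~ adj T u y) ->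
  acyclic T -> acyclic add_edge.
Proof.
move=> isoy acT c sc /andP[cc uc].
have isoy' u : adj T y u = false by rewrite adj_sym (negbTE (isoy u)).
have nby u : adj add_edge y u -> u = x.
  rewrite /= /add_edge_adj isoy' eqxx eq_sym (negbTE xDy) /= => /eqP.
  by [].
have [yc|yc] := boolP (y \in c).
  (* Rotated to start at [y], the cycle has [x], the sole neighbour of [y], both as second and as
     last entry; with more than two entries these are distinct positions. *)
  have [i p Ep] := rot_to yc.
  have up : uniq (y :: p) by rewrite -Ep rot_uniq.
  have : cycle add_edge_adj (y :: p) by rewrite -Ep rot_cycle.
  have: 2 < size (y :: p) by rewrite -Ep size_rot.
  case: p up {Ep} => // z1 p; case/lastP: p => // p z2 up _.
  rewrite /= rcons_path last_rcons => /andP[/nby z1x /andP[_]].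
  rewrite [add_edge_adj _ _]add_edge_sym => /nby z2x.
  by move: up; rewrite z1x z2x /= !mem_rcons !in_cons eqxx /= andbF.
apply: (acT c sc); rewrite /ucycle uc andbT.
apply: (sub_in_cycle (P := predC1 y)) cc; last first.
  by apply/allP=> u uc'; apply: contraNneq yc => <-.
move=> u v; rewrite !inE => uy vy.
by rewrite /= /add_edge_adj (negbTE uy) (negbTE vy) andbF orbF.
Qed.

End Pendant.

(** * Growing odd trees *)

Section OddTrees.
Variable V : finType.
Implicit Types (G H T : sgraph V) (S : {set V}).

Definition empty_graph : sgraph V :=
  @SGraph V (fun _ _ => false) (fun _ _ => erefl) (fun _ => erefl).

(** The tree stays a graph on the whole of [V], with the vertices outside [S] isolated, so that it
    can grow without a change of vertex type. *)
Definition tree_on T S : Prop :=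
  [/\ forall u v, adj T u v -> u \in S,
      {in S &, forall u v, connect (adj T) u v} & acyclic T].

Lemma tree_on1 x : tree_on empty_graph [set x].
Proof.
split=> [//|u v /set1P-> /set1P->|[|a[|b c]] //]; exact: connect0.
Qed.

Lemma tree_on_pendant T S x y (xDy : x != y) :
  x \in S -> y \notin S -> tree_on T S -> tree_on (add_edge T xDy) (y |: S).
Proof.
move=> xS yS [TS cT acT].
have isoy u : ~~ adj T u y by rewrite adj_sym; apply: contra yS => /TS.
have sub : subrel (connect (adj T)) (connect (adj (add_edge T xDy))).
  by apply: connect_sub => u v uv; apply: connect1; rewrite /= /add_edge_adj uv.
have xy : adj (add_edge T xDy) x y by rewrite /= /add_edge_adj !eqxx /= orbT.
have yx : adj (add_edge T xDy) y x by rewrite adj_sym.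
split.
- move=> u v /= /or3P[/TS uS|/andP[/eqP-> _]|/andP[/eqP-> _]]; rewrite !inE.
  + by rewrite uS orbT.
  + by rewrite xS orbT.
  + by rewrite eqxx.
- move=> u v /setU1P[->|uS] /setU1P[->|vS].
  + exact: connect0.
  + exact: connect_trans (connect1 yx) (sub _ _ (cT _ _ xS vS)).
  + exact: connect_trans (sub _ _ (cT _ _ uS xS)) (connect1 xy).
  + exact: sub (cT _ _ uS vS).
- exact: acyclic_add_pendant.
Qed.

(* Adding pendant edges two at a time at the same vertex keeps every degree
   odd, which avoids any bookkeeping of degrees in the constructions. *)
Inductive odd_tree_on H : {set V} -> Prop :=
| odd_tree_edge x y : adj H x y -> odd_tree_on H [set y; x]
| odd_tree_cherry S x y z : odd_tree_on H S -> x \in S ->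
    y \notin S -> z \notin S -> y != z -> adj H x y -> adj H x z ->
    odd_tree_on H (z |: (y |: S)).

Lemma adj_neq H x y : adj H x y -> x != y.
Proof. by apply: contraTneq => ->; rewrite adj_irrefl. Qed.

Lemma subrel_add_edge H T x y (xDy : x != y) :
  subrel (adj T) (adj H) -> adj H x y -> subrel (adj (add_edge T xDy)) (adj H).
Proof.
move=> sTH xy u v /= /or3P[/sTH //|/andP[/eqP-> /eqP->] //|/andP[/eqP-> /eqP->]].
by rewrite adj_sym.
Qed.

Lemma odd_tree_on_sound H S : odd_tree_on H S ->
  exists T, [/\ subrel (adj T) (adj H), tree_on T S
              & forall x, x \in S -> odd (degree T x)].
Proof.
elim=> {S} [x y xy|S x y z _ [T [sTH tT dT]] xS yS zS yz xy xz].
  have xDy := adj_neq xy.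
  exists (add_edge empty_graph xDy); split.
  - exact: subrel_add_edge.
  - by apply: tree_on_pendant (tree_on1 x); rewrite inE // eq_sym.
  - have d0 u : degree empty_graph u = 0 by apply: eq_card0 => v; rewrite inE.
    move=> u; rewrite degree_add_edge // d0 add0n !inE.
    by case/orP=> /eqP->; rewrite eqxx ?(negbTE xDy) // eq_sym (negbTE xDy).
have xDy := adj_neq xy; have xDz := adj_neq xz.
have [TS _ _] := tT.
exists (add_edge (add_edge T xDy) xDz); split.
- by do 2!apply: subrel_add_edge => //.
- apply: tree_on_pendant; last exact: tree_on_pendant.
  + by rewrite inE xS orbT.
  + by rewrite !inE negb_or eq_sym yz.
have nxy : ~~ adj T x y by rewrite adj_sym; apply: contra yS => /TS.
have nxz : ~~ adj T x z by rewrite adj_sym; apply: contra zS => /TS.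
have d0 w : w \notin S -> degree T w = 0.
  move=> wS; apply: eq_card0 => u; rewrite inE; apply/negbTE.
  by apply: contra wS => /TS.
move=> u uS; rewrite !degree_add_edge //; last first.
  by rewrite /= /add_edge_adj negb_or nxz eqxx /= (negbTE xDy) /= orbF eq_sym.
case/setU1P: uS => [->|/setU1P[->|uS]].
- by rewrite d0 // eq_sym (negbTE xDz) eq_sym (negbTE yz) eqxx.
- by rewrite d0 // eq_sym (negbTE xDy) eqxx (negbTE yz).
(* The degree of an old vertex grows by twice the indicator of [u == x]. *)
- have -> : (u == y) = false by apply: contraNF yS => /eqP<-.
  have -> : (u == z) = false by apply: contraNF zS => /eqP<-.
  by rewrite !addn0 -addnA oddD dT // addnn odd_double.
Qed.

Lemma odd_tree_on_card H S : odd_tree_on H S -> 0 < #|S| /\ ~~ odd #|S|.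
Proof.
elim=> {S} [x y /adj_neq xy|S x y z _ [S0 evS] xS yS zS yz _ _].
  by rewrite cards2 eq_sym xy.
rewrite !cardsU1 !inE negb_or eq_sym yz zS yS.
by rewrite addnA oddD (negbTE evS).
Qed.

Lemma odd_tree_onT H : odd_tree_on H setT -> has_odd_spanning_tree H.
Proof.
move=> tH; have [V0 _] := odd_tree_on_card tH.
have [T [sTH [_ cT acT] dT]] := odd_tree_on_sound tH; exists T; split.
  split=> //; split=> //; split; first by rewrite -cardsT.
  by move=> x y; apply: cT; rewrite inE.
by apply/forallP=> x; apply: dT; rewrite inE.
Qed.

(** Leaves are attached at [x] in pairs, by induction on a bound for the size of [L]; evenness
    ensures that none is left over. *)
Lemma odd_tree_on_leaves H S (L : {set V}) x : odd_tree_on H S -> x \in S ->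
  [disjoint L & S] -> ~~ odd #|L| -> {in L, forall y, adj H x y} ->
  odd_tree_on H (L :|: S).
Proof.
move: {2}#|L| (leqnn #|L|) => n; elim: n L S => [|n IHn] L S.
  by rewrite leqn0 cards_eq0 => /eqP-> tS; rewrite set0U.
move=> leL tS xS dLS evL xL.
have [->|[y yL]] := set_0Vmem L; first by rewrite set0U.
have cL := cardsD1 y L; rewrite yL in cL.
have [L'0|[z zL']] := set_0Vmem (L :\ y).
  by move: evL; rewrite cL L'0 cards0.
have cL' := cardsD1 z (L :\ y); rewrite zL' in cL'.
have [zy zL] : z != y /\ z \in L by apply/andP; rewrite -in_setD1.
have yS := disjointFr dLS yL; have zS := disjointFr dLS zL.
have -> : L :|: S = (L :\ y :\ z) :|: (z |: (y |: S)).
  apply/setP=> w; rewrite !inE; case: eqP => [->|_] /=; first by rewrite zL.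
  by case: eqP => [->|_] //=; rewrite yL.
apply: IHn.
- by move: leL; rewrite cL cL' !add1n ltnS; apply: ltnW.
- by apply: (odd_tree_cherry (x := x)); rewrite ?yS ?zS ?xL // eq_sym.
- by rewrite !inE xS !orbT.
- rewrite disjoint_subset; apply/subsetP=> w.
  rewrite !inE => /and3P[/negbTE-> /negbTE-> wL] /=.
  by rewrite (disjointFr dLS wL).
- by move: evL; rewrite cL cL' /= negbK.
- by move=> w; rewrite !inE => /and3P[_ _ /xL].
Qed.

(** The centre has an odd number of leaves: one forms the initial edge and the others come in
    pairs. *)
Lemma odd_tree_on_star H S x : x \in S -> ~~ odd #|S| ->
  {in S :\ x, forall y, adj H x y} -> odd_tree_on H S.
Proof.
move=> xS evS xH; have cS := cardsD1 x S; rewrite xS in cS.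
have [S0|[y yS']] := set_0Vmem (S :\ x).
  by move: evS; rewrite cS S0 cards0.
have cS' := cardsD1 y (S :\ x); rewrite yS' in cS'.
have [yx yS] : y != x /\ y \in S by apply/andP; rewrite -in_setD1.
have -> : S = (S :\ x :\ y) :|: [set y; x].
  apply/setP=> w; rewrite !inE; case: (w =P y) => [->|_] /=; first by rewrite yS.
  by case: eqP => [->|_] //=; rewrite ?orbF.
apply: (odd_tree_on_leaves (x := x)).
- exact: odd_tree_edge (xH y yS').
- by rewrite !inE eqxx orbT.
- rewrite disjoint_subset; apply/subsetP=> w.
  by rewrite !inE => /and3P[/negbTE-> /negbTE->].
- by move: evS; rewrite cS cS' /= negbK.
- by move=> w /setD1P[_]; apply: xH.
Qed.

Lemma odd_cardsC S : ~~ odd #|V| -> odd #|~: S| = odd #|S|.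
Proof. by rewrite -(cardsC S) oddD; do 2!case: (odd _). Qed.

(** This ends the constructions below: an odd tree has even order, so an even number of vertices
    remain and all of them can hang from [x]. *)
Lemma odd_tree_on_complete H S x : ~~ odd #|V| -> odd_tree_on H S -> x \in S ->
  (forall y, y \notin S -> adj H x y) -> has_odd_spanning_tree H.
Proof.
move=> evV tS xS xH; apply: odd_tree_onT.
have [_ evS] := odd_tree_on_card tS.
rewrite -(setUCr S) setUC; apply: (odd_tree_on_leaves (x := x)) => //.
- by rewrite disjoint_sym disjoints_subset setCK.
- by rewrite odd_cardsC.
- by move=> y; rewrite inE; apply: xH.
Qed.

(** The tree is a star at [x] on [P], then the edges from [b] to [a1] and [a2], then all other
    vertices outside [P] as leaves at [a2]. *)
Lemma two_stars_odd_tree H (P : {set V}) x b a1 a2 :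
  ~~ odd #|V| -> ~~ odd #|P| -> x \in P -> {in P :\ x, forall y, adj H x y} ->
  b \in P -> a1 \notin P -> a2 \notin P -> a1 != a2 ->
  adj H b a1 -> adj H b a2 ->
  (forall y, y \notin P -> y != a1 -> y != a2 -> adj H a2 y) ->
  has_odd_spanning_tree H.
Proof.
move=> evV evP xP xH bP a1P a2P a12 ba1 ba2 a2H.
apply: (odd_tree_on_complete (S := a2 |: (a1 |: P)) (x := a2)) => //.
- by apply: (odd_tree_cherry (x := b)) => //; apply: odd_tree_on_star xH.
- by rewrite !inE eqxx.
- by move=> y; rewrite !inE !negb_or => /and3P[y2 y1 yP]; apply: a2H.
Qed.

(** The tree is a star at [x] avoiding the four [d]'s, with [d1], [d2] then hung from [u] and [d3],
    [d4] from [v]. As they come last, [v] may itself be [d1] or [d2]. *)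
Lemma star_two_cherries_odd_tree H x u v d1 d2 d3 d4 :
  ~~ odd #|V| -> uniq [:: d1; d2; d3; d4] -> x \notin [:: d1; d2; d3; d4] ->
  (forall y, y \notin [:: x; d1; d2; d3; d4] -> adj H x y) ->
  u \notin [:: d1; d2; d3; d4] -> adj H u d1 -> adj H u d2 ->
  v \notin [:: d3; d4] -> adj H v d3 -> adj H v d4 ->
  has_odd_spanning_tree H.
Proof.
move=> evV ud xd xH ud' ud1 ud2 vd vd3 vd4; apply: odd_tree_onT.
pose D := [set z in [:: d1; d2; d3; d4]].
have -> : setT = d4 |: (d3 |: (d2 |: (d1 |: ~: D))).
  by apply/setP=> z; rewrite !inE; do 4!case: eqP => //=.
have cD : #|D| = 4 by rewrite cardsE; apply/card_uniqP.
move: (ud); rewrite /= !inE !negb_or !andbT.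
case/and3P=> /and3P[d12 d13 d14] /andP[d23 d24] d34.
have tD : odd_tree_on H (~: D).
  apply: (odd_tree_on_star (x := x)); first by rewrite !inE in xd *.
    by rewrite odd_cardsC // cD.
  by move=> y; rewrite inE => /andP[yx yD]; apply: xH; rewrite !inE in yx yD *;
     rewrite negb_or yx.
have dT1 : odd_tree_on H (d2 |: (d1 |: ~: D)).
  by apply: (odd_tree_cherry (x := u)) => //; rewrite !inE ?eqxx ?orbT // in ud' *.
apply: (odd_tree_cherry (x := v)) => //.
- by move: vd; rewrite !inE !negb_or => /andP[-> ->]; do 2!case: (v == _).
- by rewrite !inE eqxx !orbT !negb_or ![d3 == _]eq_sym d13 d23.
- by rewrite !inE eqxx !orbT !negb_or ![d4 == _]eq_sym d14 d24.
Qed.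

End OddTrees.

(** * Obstructions to odd spanning trees *)

Section Obstructions.
Variable V : finType.
Implicit Types (G H T : sgraph V) (P : {set V}).

Lemma degreeE T x : degree T x = \sum_y adj T x y.
Proof.
rewrite /degree -sum1_card big_mkcond /=.
by apply: eq_bigr => y _; rewrite inE; case: adj.
Qed.

(** Handshake lemma for the subgraph induced on [P]: deleting [z] removes its row and its column
    from the sum, and these are equal by symmetry. *)
Lemma even_sum_adj T P : ~~ odd (\sum_(x in P) \sum_(y in P) adj T x y).
Proof.
move: {2}#|P| (leqnn #|P|) => n; elim: n P => [|n IHn] P.
  by rewrite leqn0 cards_eq0 => /eqP->; rewrite big_set0.
have [->|[z zP]] := set_0Vmem P; first by rewrite big_set0.
rewrite (cardsD1 z) zP add1n ltnS => /IHn evP.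
rewrite (big_setD1 z) //= (big_setD1 z) //= adj_irrefl add0n.
under [X in _ + X]eq_bigr => x _ do rewrite (big_setD1 z) //= adj_sym.
by rewrite big_split /= addnA addnn oddD odd_double.
Qed.

Lemma connected_cut T P x y : connected T -> x \in P -> y \notin P ->
  exists u v, [/\ u \in P, v \notin P & adj T u v].
Proof.
move=> [_ /(_ x y)/connectP[p]]; elim: p x => [|z p IHp] x /=.
  by move=> _ -> xP; rewrite xP.
case/andP=> xz pz yp xP yP; have [zP|zP] := boolP (z \in P).
  exact: IHp pz yp zP yP.
by exists x, z.
Qed.

(** The degree sum over [P] is even, as is the part of it counted inside [P], so the number of edges
    leaving [P] is even. Connectivity makes it positive, hence some edge differs from any prescribed
    one. *)
Lemma even_cut_has_two_edges T P x y : odd_graph T -> connected T ->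
  ~~ odd #|P| -> x \in P -> y \notin P ->
  forall a b, exists u v, [/\ u \in P, v \notin P, adj T u v & (u, v) != (a, b)].
Proof.
move=> oT cT evP xP yP a b.
have [u0 [v0 [u0P v0P u0v0]]] := connected_cut cT xP yP.
have [/eqP[ua vb]|] := boolP ((u0, v0) == (a, b)); last by exists u0, v0.
have [/existsP[[u v] /and4P[]]|] := boolP [exists e : V * V, [&& e.1 \in P,
    e.2 \notin P, adj T e.1 e.2 & e != (a, b)]]; first by exists u, v.
(* Otherwise [(u0, v0)] is the only edge leaving [P], and the degree sum over [P] is both even and
   odd. *)
move/existsPn=> no; subst a b.
have sumP : \sum_(x in P) degree T x =
    \sum_(x in P) \sum_(y in P) adj T x y +
    \sum_(x in P) \sum_(y in ~: P) adj T x y.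
  rewrite -big_split; apply: eq_bigr => w _ /=.
  rewrite degreeE (bigID (mem P)) /=; congr (_ + _).
  by apply: eq_bigl => z; rewrite inE.
have : odd (\sum_(x in P) degree T x) = odd #|P|.
  rewrite -sum1_card !(big_morph odd oddD (erefl _)).
  by apply: eq_bigr => w _; rewrite (forallP oT).
rewrite sumP oddD (negbTE evP) (negbTE (even_sum_adj _ _)) /=.
have nv0 : v0 \in ~: P by rewrite inE.
rewrite (big_setD1 u0) //= (big_setD1 v0) //= u0v0 big1 ?big1 //.
- move=> u /setD1P[uu uP]; apply: big1 => v; rewrite inE => vP.
  move: (no (u, v)); rewrite /= uP vP xpair_eqE (negbTE uu) /= andbT.
  by case: (adj T u v).
- move=> v /setD1P[vv]; rewrite inE => vP.
  move: (no (u0, v)); rewrite /= u0P vP xpair_eqE (negbTE vv) andbF /= andbT.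
  by case: (adj T u0 v).
Qed.

Lemma no_odd_spanning_tree_of_cut H P x y a b : ~~ odd #|P| ->
  x \in P -> y \notin P ->
  (forall u v, u \in P -> v \notin P -> adj H u v -> (u, v) = (a, b)) ->
  ~ has_odd_spanning_tree H.
Proof.
move=> evP xP yP cut [T [[sTH [cT _]] oT]].
have [u [v [uP vP uv]]] := even_cut_has_two_edges oT cT evP xP yP a b.
by rewrite (cut _ _ uP vP (sTH _ _ uv)) eqxx.
Qed.

Definition is_inl (A B : Type) (w : A + B) : bool := if w is inl _ then true else false.

Lemma card_inl_preimage m n (f : V -> 'I_m + 'I_n) : bijective f ->
  #|[set x | is_inl (f x)]| = m.
Proof.
case=> g fK gK.
have -> : [set x | is_inl (f x)] = [set g (inl i) | i : 'I_m].
  apply/setP=> x; rewrite inE; apply/idP/imsetP => [|[i _ ->]]; last by rewrite gK.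
  by case E: (f x) => [i|//] _; exists i => //; rewrite -E fK.
rewrite card_imset ?card_ord // => i j /(can_inj gK) [] //.
Qed.

Lemma Kmn_no_odd_spanning_tree G s t : 0 < s -> 0 < t ->
  isomorphic G (Kmn (2 * s) (2 * t)) -> ~ has_odd_spanning_tree (compl G).
Proof.
move=> s0 t0 [f [bf fG]]; have [g fK gK] := bf.
have s0' : 0 < 2 * s by rewrite muln_gt0.
have t0' : 0 < 2 * t by rewrite muln_gt0.
(* No edge of the complement joins the two sides; [a] and [b] show that both sides are inhabited. *)
pose a := g (inl (Ordinal s0')); pose b := g (inr (Ordinal t0')).
apply: (@no_odd_spanning_tree_of_cut _ [set x | is_inl (f x)] a b a b).
- by rewrite card_inl_preimage // oddM.
- by rewrite inE gK.
- by rewrite inE gK.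
- move=> u v; rewrite !inE /= /compl_adj -fG.
  by case: (f u) (f v) => [i|i] [j|j] //= _ _; rewrite andbF.
Qed.

Lemma Kmn_del_edge_no_odd_spanning_tree G s t : 0 < s -> 0 < t ->
  isomorphic_del_edge G (Kmn (2 * s) (2 * t)) -> ~ has_odd_spanning_tree (compl G).
Proof.
move=> s0 t0 [a' [b' [ab' [f [bf fG]]]]]; have [g fK gK] := bf.
(* The deleted edge may be listed from either end; it is oriented from left to right. *)
have [a [b [ab fG']]] : exists a b, adj (Kmn (2 * s) (2 * t)) (inl a) (inr b) /\
    forall x y, adj G x y = adj (del_edge (Kmn (2 * s) (2 * t)) (inl a) (inr b)) (f x) (f y).
  case: a' b' ab' fG => [a|b] [a'|b'] // _ fG.
    by exists a, b'; split=> // x y; rewrite -fG.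
  by exists a', b; split=> // x y; rewrite -fG /= /del_adj [in RHS]orbC.
apply: (@no_odd_spanning_tree_of_cut _ [set x | is_inl (f x)]
         (g (inl a)) (g (inr b)) (g (inl a)) (g (inr b))).
- by rewrite card_inl_preimage // oddM.
- by rewrite inE gK.
- by rewrite inE gK.
- move=> u v; rewrite !inE /= /compl_adj fG' /= /del_adj => fu fv /andP[_].
  move: fu fv (fK u) (fK v).
  case: (f u) (f v) => [i|i] [j|j] //= _ _ <- <-.
  by rewrite negbK orbF => /andP[/eqP[->] /eqP[->]].
Qed.

Lemma degree_seqE T (s : seq V) x : uniq s -> (forall y, y \in s) ->
  degree T x = \sum_(y <- s) adj T x y.
Proof.
move=> us sV; rewrite degreeE; apply: perm_big.
apply: uniq_perm => //; first exact: index_enum_uniq.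
by move=> y; rewrite sV mem_index_enum.
Qed.

(** The complement has at most the eight edges [v v'], [v w2], [v w3], [v' w2], [v' w3], [w1 w3],
    [w1 w4], [w2 w4]. Parity at the four [w]'s forces a component of two vertices or a 4-cycle. *)
Lemma C5_2_no_odd_spanning_tree G v v' w1 w2 w3 w4 :
  uniq [:: v; v'; w1; w2; w3; w4] ->
  (forall z, z \in [:: v; v'; w1; w2; w3; w4]) ->
  adj G v w1 -> adj G v' w1 -> adj G v w4 -> adj G v' w4 ->
  adj G w1 w2 -> adj G w2 w3 -> adj G w3 w4 ->
  ~ has_odd_spanning_tree (compl G).
Proof.
move=> us sV vw1 v'w1 vw4 v'w4 w12 w23 w34 [T [[sTG [cT acT]] oT]].
have nT x y : adj G x y -> adj T x y = false.
  by move=> xy; apply/negP=> /sTG /=; rewrite /compl_adj xy andbF.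
have nT' x y : adj G x y -> adj T y x = false by rewrite adj_sym; apply: nT.
have deg x : odd (\sum_(y <- [:: v; v'; w1; w2; w3; w4]) adj T x y).
  by rewrite -degree_seqE //; apply: (forallP oT).
have no_cut (s : seq V) x y : x \in s -> y \notin s ->
    {in s, forall u, forall w, adj T u w -> w \in s} -> False.
  move=> xs ys cl; have [||u [w]] := @connected_cut _ [set z in s] x y cT.
  - by rewrite inE.
  - by rewrite inE.
  - by rewrite !inE => -[us' ws] /(cl _ us'); rewrite (negbTE ws).
have F := (nT _ _ vw1, nT _ _ v'w1, nT _ _ vw4, nT _ _ v'w4, nT _ _ w12,
  nT _ _ w23, nT _ _ w34, nT' _ _ vw1, nT' _ _ v'w1, nT' _ _ vw4, nT' _ _ v'w4,
  nT' _ _ w12, nT' _ _ w23, nT' _ _ w34).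
have := deg w1; have := deg w2; have := deg w3; have := deg w4.
rewrite !big_cons !big_nil !adj_irrefl !addn0 !F.
rewrite [adj T w4 w1]adj_sym [adj T w4 w2]adj_sym [adj T w3 w1]adj_sym.
have vs : v \notin [:: w1; w2; w3; w4].
  by move: us; rewrite /= !inE !negb_or => /andP[/andP[_ ->]].
have pair_closed x y : x \in [:: w1; w2; w3; w4] -> y \in [:: w1; w2; w3; w4] ->
    (forall w, adj T x w -> w \in [:: x; y]) ->
    (forall w, adj T y w -> w \in [:: x; y]) -> False.
  move=> xs ys cx cy; apply: (no_cut [:: x; y] x v); first by rewrite !inE eqxx.
    apply: contra vs; rewrite !inE => /orP[]/eqP->; first by rewrite !inE in xs.
    by rewrite !inE in ys.
  by move=> u; rewrite !inE => /orP[]/eqP-> w; [move/cx|move/cy]; rewrite !inE.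
have Vcase (Q : V -> Prop) : Q v -> Q v' -> Q w1 -> Q w2 -> Q w3 -> Q w4 ->
    forall w, Q w.
  by move=> ? ? ? ? ? ? w; have := sV w; rewrite !inE;
     do 5?[case/orP]; move/eqP->.
(* If [w1 w4] is in [T], parity excludes [w1 w3] and [w2 w4], so [w1] and [w4] form a component. *)
have [a14|a14] := boolP (adj T w1 w4).
  case a24: (adj T w2 w4) => //; case a13: (adj T w1 w3) => // _ _ _ _.
  have a42 : adj T w4 w2 = false by rewrite adj_sym.
  apply: (pair_closed w1 w4); rewrite ?inE ?eqxx ?orbT //; apply: Vcase;
    by rewrite ?F ?adj_irrefl ?inE ?eqxx ?orbT ?a42 ?a13.
have a41 : adj T w4 w1 = false by rewrite adj_sym; apply: negbTE.
(* Now [w1 w3] and [w2 w4] are in [T], so each of [w3] and [w2] is joined to both or neither of [v],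
   [v']. Neither splits off a component of two vertices. *)
case a24: (adj T w2 w4) => //; case a13: (adj T w1 w3) => // _.
case a3: (adj T w3 v); last first.
  case a3': (adj T w3 v') => // _ _ _; apply: (pair_closed w1 w3);
    rewrite ?inE ?eqxx ?orbT //; apply: Vcase;
    by rewrite ?F ?adj_irrefl ?inE ?eqxx ?orbT // ?a3 ?a3' ?(negbTE a14).
case a3': (adj T w3 v') => // _.
case a2: (adj T w2 v); last first.
  case a2': (adj T w2 v') => // _ _; apply: (pair_closed w2 w4);
    rewrite ?inE ?eqxx ?orbT //; apply: Vcase;
    by rewrite ?F ?adj_irrefl ?inE ?eqxx ?orbT // ?a2 ?a2' ?a41.
case a2': (adj T w2 v') => // _ _.
(* Both [w2] and [w3] are joined to both copies, which closes a 4-cycle. *)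
apply: (acT [:: v; w3; v'; w2]) => //; rewrite /ucycle /= a3' a2.
rewrite adj_sym a3 adj_sym a2' /=.
move: us; rewrite /= !inE !negb_or ![w3 == _]eq_sym.
by case/and5P=> /and5P[-> _ -> -> _] /and4P[_ -> -> _] _ /andP[-> _] _.
Qed.

End Obstructions.

(** * Recognising the graph [C_5(2)] *)

Section C5Blowup.

Local Notation W := ({x : 'I_5 | x != ord0} + 'I_2)%type.

(** The index is shifted by one so that the vertex differs from [ord0] by computation. *)
Definition C5_2_vertex (k : nat) (lt_k : k.+1 < 5) : W :=
  inl (exist (fun x : 'I_5 => x != ord0) (Ordinal lt_k) isT).

Local Notation w1 := (@C5_2_vertex 0 isT).
Local Notation w2 := (@C5_2_vertex 1 isT).
Local Notation w3 := (@C5_2_vertex 2 isT).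
Local Notation w4 := (@C5_2_vertex 3 isT).
Local Notation v0 := (inr (@Ordinal 2 0 isT) : W).
Local Notation v1 := (inr (@Ordinal 2 1 isT) : W).

Lemma C5_2_ind (Q : W -> Prop) :
  Q v0 -> Q v1 -> Q w1 -> Q w2 -> Q w3 -> Q w4 -> forall p, Q p.
Proof.
move=> Q0 Q1 Q2 Q3 Q4 Q5 [[[k ltk] nk]|[k ltk]]; last first.
  by case: k ltk => [|[|k]] ltk //; rewrite (bool_irrelevance ltk isT).
case: k ltk nk => [|[|[|[|[|k]]]]] ltk nk //;
  by rewrite (bool_irrelevance ltk isT) (bool_irrelevance nk isT).
Qed.

Variables (V : finType) (G : sgraph V).

(** Seven edges suffice: any two nonadjacent vertices of [C_5(2)] have a common neighbour, so
    triangle-freeness yields all the non-edges, and also the distinctness of the vertices other than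
    [v] and [v']. *)
Lemma C5_2_isomorphic v v' u1 u2 u3 u4 : triangle_free G -> #|V| = 6 -> v != v' ->
  adj G v u1 -> adj G v' u1 -> adj G v u4 -> adj G v' u4 ->
  adj G u1 u2 -> adj G u2 u3 -> adj G u3 u4 ->
  isomorphic G (C5_blowup 2).
Proof.
move=> tf cV vv' a1 a2 a3 a4 a5 a6 a7.
have tri x y z : adj G x y -> adj G y z -> adj G x z -> False.
  by move=> xy yz; apply/negP; apply: tf xy yz.
have sym x y : adj G x y -> adj G y x by rewrite adj_sym.
have b1 := sym _ _ a1; have b2 := sym _ _ a2; have b3 := sym _ _ a3.
have b4 := sym _ _ a4; have b5 := sym _ _ a5; have b6 := sym _ _ a6.
have b7 := sym _ _ a7.
have us : uniq [:: v; v'; u1; u2; u3; u4].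
  rewrite /= !inE !negb_or vv' /=.
  by repeat (apply/andP; split) => //; apply/eqP => E; subst; eauto using tri.
have ntri x y z : adj G x y -> adj G y z -> adj G x z = false.
  by move=> xy yz; apply: negbTE; apply: tf xy yz.
(* Position in the list below: the two copies come first, so vertex [i] of the cycle, with [i] from
   1 to 4, has index [i + 1]. *)
pose h (p : W) : nat := match p with inl k => (val (val k)).+1 | inr i => val i end.
pose g p := nth v [:: v; v'; u1; u2; u3; u4] (h p).
have h6 p : h p < 6 by elim/C5_2_ind: p.
have hinj : injective h by apply: C5_2_ind; apply: C5_2_ind.
have ginj : injective g.
  by move=> p q /eqP; rewrite /g nth_uniq // => /eqP/hinj.
have gb : bijective g.
  apply: inj_card_bij => //.
  by rewrite cV card_sum card_sig cardC1 !card_ord.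
have gG p q : adj G (g p) (g q) = adj (C5_blowup 2) p q.
  elim/C5_2_ind: p; elim/C5_2_ind: q; rewrite /g /h /=;
    first [by rewrite adj_irrefl | by [] | by rewrite adj_sym | by eauto using ntri].
have [f gK fK] := gb; exists f; split; first by exists g.
by move=> x y; rewrite -gG !fK.
Qed.

Lemma C5_blowup2_no_odd_spanning_tree :
  isomorphic G (C5_blowup 2) -> ~ has_odd_spanning_tree (compl G).
Proof.
case=> f [[g fK gK] fG].
have gG p q : adj G (g p) (g q) = adj (C5_blowup 2) p q by rewrite -fG !gK.
apply: (@C5_2_no_odd_spanning_tree _ _ (g v0) (g v1) (g w1) (g w2) (g w3) (g w4));
  rewrite ?gG //.
- by rewrite -[X in uniq X]/(map g [:: v0; v1; w1; w2; w3; w4])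
    (map_inj_uniq (can_inj gK)).
- move=> z; rewrite -(fK z) -[X in _ \in X]/(map g [:: v0; v1; w1; w2; w3; w4]).
  by apply: map_f; elim/C5_2_ind: (f z).
Qed.

End C5Blowup.

(** * Complete bipartite graphs with missing edges *)

Section Bipartite.
Variable V : finType.
Implicit Types (G : sgraph V) (P A : {set V}).

Lemma split_bijection P m n x y : #|P| = m -> #|~: P| = n -> x \in P -> y \notin P ->
  exists f : V -> 'I_m + 'I_n, bijective f /\ forall z, is_inl (f z) = (z \in P).
Proof.
move=> cP cC xP; rewrite -in_setC => yP.
(* The members [x] and [y] of the two sides are the default elements for [enum_rank_in]. *)
pose f z : 'I_m + 'I_n := if z \in P then inl (cast_ord cP (enum_rank_in xP z))
  else inr (cast_ord cC (enum_rank_in yP z)).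
exists f; split; last by move=> z; rewrite /f; case: ifP.
apply: inj_card_bij; last by rewrite card_sum !card_ord -cP -cC cardsC.
move=> z1 z2; rewrite /f; case: ifP => z1P; case: ifP => z2P // [] /val_inj E.
  by rewrite -(enum_rankK_in xP z1P) E enum_rankK_in.
by rewrite -[z1](enum_rankK_in yP) ?E ?enum_rankK_in // inE ?z1P ?z2P.
Qed.

Lemma Kmn_adjE m n p q : @Kmn_adj m n p q = is_inl p (+) is_inl q.
Proof. by case: p q => [?|?] [?|?]. Qed.

Lemma Kmn_isomorphic G P x y : x \in P -> y \notin P ->
  (forall u v, adj G u v = (u \in P) (+) (v \in P)) ->
  isomorphic G (Kmn #|P| #|~: P|).
Proof.
move=> xP yP GP.
have [f [bf fP]] := split_bijection (erefl #|P|) (erefl #|~: P|) xP yP.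
by exists f; split=> // u v; rewrite /= Kmn_adjE !fP GP.
Qed.

Lemma Kmn_del_edge_isomorphic G P a b : a \in P -> b \notin P ->
  (forall u v, adj G u v = ((u \in P) (+) (v \in P)) &&
     ~~ ((u == a) && (v == b) || (u == b) && (v == a))) ->
  isomorphic_del_edge G (Kmn #|P| #|~: P|).
Proof.
move=> aP bP GP.
have [f [bf fP]] := split_bijection (erefl #|P|) (erefl #|~: P|) aP bP.
exists (f a), (f b); split; first by rewrite /= Kmn_adjE !fP aP (negbTE bP).
exists f; split=> // u v.
by rewrite /= /del_adj /= Kmn_adjE !fP GP !(inj_eq (bij_inj bf)).
Qed.

(** With a fourth vertex [d] outside [A], the tree is a star at [x] on the complement of [A] without
    [b2] and [d]; then [b1] takes [b2] and [a1], [b2] takes [d] and [a2], and [a1] takes the rest of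
    [A]. *)
Lemma two_cliques_matching_odd_tree (H : sgraph V) A a1 a2 x b1 b2 :
  ~~ odd #|V| -> ~~ odd #|A| ->
  a1 \in A -> a2 \in A -> a1 != a2 -> uniq [:: x; b1; b2] ->
  x \notin A -> b1 \notin A -> b2 \notin A ->
  {in A &, forall u v, u != v -> adj H u v} ->
  {in ~: A &, forall u v, u != v -> adj H u v} ->
  adj H b1 a1 -> adj H b2 a2 -> has_odd_spanning_tree H.
Proof.
move=> evV evA a1A a2A a12 /=; rewrite !inE !negb_or andbT => /andP[/andP[xb1 xb2] b12].
move=> xA b1A b2A clA clB e1 e2.
have evB : ~~ odd #|~: A| by rewrite odd_cardsC.
(* The complement of [A] has even order, so it is not just the three given vertices. *)
have [B0|[d]] := set_0Vmem (~: A :\: [set x; b1; b2]).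
  have : ~: A = [set x; b1; b2].
    apply/eqP; rewrite eqEsubset -setD_eq0 B0 eqxx /=.
    by apply/subsetP=> z; rewrite !inE -orbA => /or3P[]/eqP->.
  move=> EB; move: evB; rewrite EB -setUA cardsU1 cards2 !inE negb_or.
  by rewrite xb1 xb2 b12.
rewrite !inE !negb_or => /andP[/andP[/andP[dx db1] db2] dA].
pose S := ~: A :\: [set b2; d].
have inS z : z \in S = [&& z != b2, z != d & z \notin A].
  by rewrite !inE negb_or andbA.
have evS : ~~ odd #|S|.
  have : #|S| + 2 = #|~: A|.
    rewrite -(cardsID [set b2; d] (~: A)) addnC; congr (_ + _).
    rewrite (setIidPr _) ?cards2 1?eq_sym ?db2 //.
    by apply/subsetP=> z; rewrite !inE => /orP[]/eqP->.
  by move=> E; move: evB; rewrite -E oddD addbF.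
have tS : odd_tree_on H S.
  apply: (odd_tree_on_star (x := x)) => //; first by rewrite inS xb2 eq_sym dx.
  move=> y /setD1P[yx]; rewrite inS => /and3P[_ _ yA].
  by apply: clB; rewrite ?inE // eq_sym.
have neqA u w : u \notin A -> w \in A -> u != w.
  by move=> uA wA; apply: contraNneq uA => ->.
have tS1 : odd_tree_on H (a1 |: (b2 |: S)).
  apply: (odd_tree_cherry (x := b1)) => //.
  - by rewrite inS b12 b1A eq_sym db1.
  - by rewrite inS eqxx.
  - by rewrite inS a1A !andbF.
  - exact: neqA.
  - by apply: clB; rewrite ?inE.
have tS2 : odd_tree_on H (a2 |: (d |: (a1 |: (b2 |: S)))).
  apply: (odd_tree_cherry (x := b2)) => //.
  - by rewrite !in_setU1 eqxx orbT.
  - by rewrite !in_setU1 !negb_or db2 inS eqxx andbF /= neqA.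
  - by rewrite !in_setU1 !negb_or inS a2A !andbF andbT eq_sym a12 eq_sym neqA.
  - exact: neqA.
  - by apply: clB; rewrite ?inE // eq_sym.
apply: (odd_tree_on_complete (x := a1)) tS2 _ _ => //.
  by rewrite !in_setU1 eqxx !orbT.
move=> y; rewrite !in_setU1 inS !negb_or !negb_and !negbK.
case/and5P=> ya2 yd ya1 yb2; rewrite (negbTE yd) (negbTE yb2) /= => yA.
by apply: clA => //; rewrite eq_sym.
Qed.

(** The cases are no, exactly one, or at least two missing edges between [A] and its complement,
    which are cliques of [compl G]. *)
Lemma near_complete_bipartite G A a0 x :
  ~~ odd #|V| -> ~~ odd #|A| -> a0 \in A ->
  {in A &, forall u v, ~~ adj G u v} -> {in ~: A &, forall u v, ~~ adj G u v} ->
  x \notin A -> {in A, forall a, adj G x a} ->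
  (forall b, b \notin A ->
     {in A &, forall a a', ~~ adj G b a -> ~~ adj G b a' -> a = a'}) ->
  [\/ has_odd_spanning_tree (compl G), isomorphic G (Kmn #|A| #|~: A|)
    | isomorphic_del_edge G (Kmn #|A| #|~: A|)].
Proof.
move=> evV evA a0A indA indB xA xadj miss.
have clA : {in A &, forall u v, u != v -> adj (compl G) u v}.
  by move=> u v uA vA uv; rewrite /= /compl_adj uv indA.
have clB : {in ~: A &, forall u v, u != v -> adj (compl G) u v}.
  by move=> u v uA vA uv; rewrite /= /compl_adj uv indB.
have neqA u w : u \notin A -> w \in A -> u != w.
  by move=> uA wA; apply: contraNneq uA => ->.
have indB' u v : u \notin A -> v \notin A -> adj G u v = false.
  by move=> uA vA; apply: negbTE; apply: indB; rewrite inE.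
have indA' u v : u \in A -> v \in A -> adj G u v = false.
  by move=> uA vA; apply: negbTE; apply: indA.
pose missing e := [&& e.1 \in A, e.2 \notin A & ~~ adj G e.2 e.1].
have [/existsP[[a1 b1] m1]|/existsPn full] := boolP [exists e, missing e]; last first.
  apply: Or32; apply: (Kmn_isomorphic a0A xA) => u v.
  have [uA|uA] := boolP (u \in A); have [vA|vA] := boolP (v \in A) => /=.
  - exact: indA'.
  - by rewrite adj_sym; move: (full (u, v)); rewrite /missing /= uA vA negbK.
  - by move: (full (v, u)); rewrite /missing /= uA vA negbK.
  - exact: indB'.
have /and3P[/= a1A b1A n1] := m1.
have [/existsP[[a2 b2] /andP[]]|/existsPn one] :=
  boolP [exists e, missing e && (e != (a1, b1))]; last first.
  apply: Or33; apply: (Kmn_del_edge_isomorphic a1A b1A) => u v.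
  have [uA|uA] := boolP (u \in A); have [vA|vA] := boolP (v \in A) => /=.
  - exact: indA'.
  - have -> : (u == b1) = false by rewrite eq_sym; apply: negbTE; apply: neqA.
    rewrite orbF adj_sym; case: (boolP (_ && _)) => [/andP[/eqP-> /eqP->]|ne].
      exact: negbTE.
    by move: (one (u, v)); rewrite /missing /= uA vA xpair_eqE ne andbT negbK.
  - have -> : (u == a1) = false by apply: negbTE; apply: neqA.
    rewrite /=; case: (boolP (_ && _)) => [/andP[/eqP-> /eqP->]|ne].
      exact: negbTE.
    by move: (one (v, u)); rewrite /missing /= uA vA xpair_eqE [(v == a1) && _]andbC ne andbT negbK.
  - exact: indB'.
case/and3P=> /= a2A b2A n2; rewrite xpair_eqE => ne; apply: Or31.
(* Two missing edges cannot share their end outside [A], by [miss]. *)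
have b12 : b1 != b2.
  apply: contraNneq ne => E; rewrite -E eqxx andbT; apply/eqP.
  by apply: (miss b1) => //; rewrite E.
have [E|a12] := eqVneq a1 a2.
  (* The common end [a1] is both the centre of the star on [A] and the vertex from which [b1] and
     [b2] hang. *)
  apply: (two_stars_odd_tree (P := A) (x := a1) (b := a1) (a1 := b1) (a2 := b2)) => //.
  - by move=> y /setD1P[ya yA]; apply: clA; rewrite // eq_sym.
  - by rewrite /= /compl_adj eq_sym neqA // adj_sym.
  - by rewrite /= /compl_adj eq_sym neqA // adj_sym E.
  - by move=> y yA _ yb; apply: clB; rewrite ?inE // eq_sym.
(* Being joined in [G] to all of [A], [x] differs from [b1] and [b2]. *)
apply: (@two_cliques_matching_odd_tree _ A a1 a2 x b1 b2) => //.
- rewrite /= !inE b12 !andbT negb_or.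
  by apply/andP; split; [apply: contraNneq n1|apply: contraNneq n2] => <-; apply: xadj.
- by rewrite /= /compl_adj neqA.
- by rewrite /= /compl_adj neqA.
Qed.

End Bipartite.

(** * Blown-up 5-cycles: two vertices dominating the graph *)

Section TwoDominatingVertices.
Variables (V : finType) (G : sgraph V).
Hypotheses (tfG : triangle_free G) (evV : ~~ odd #|V|).
Implicit Types (a b u v w x y : V).

Lemma compl_common_nbr w u v : u != v -> adj G w u -> adj G w v -> adj (compl G) u v.
Proof.
by move=> uv wu wv; rewrite /= /compl_adj uv; apply: tfG wv; rewrite adj_sym.
Qed.

(** When [a1] and [a2] are nonadjacent, the other vertices split into common neighbours and two
    private neighbourhoods, the three blown-up vertices of a 5-cycle. Each class is a clique of the
    complement. *)
Definition dominating_pair a1 a2 : Prop :=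
  forall v, v != a1 -> v != a2 -> adj G a1 v || adj G a2 v.

Lemma dominating_pair_sym a1 a2 : dominating_pair a1 a2 -> dominating_pair a2 a1.
Proof. by move=> dom v v2 v1; rewrite orbC dom. Qed.

Lemma neq_nbr a u v : adj G a u -> ~~ adj G a v -> u != v.
Proof. by move=> au; apply: contraNneq => <-. Qed.

(** The edge [b1 b2] of the complement carries two stars: [b1] takes [a2] and the private neighbours
    of [a1], while [b2] takes [a1] and the neighbours of [a2]. The common neighbour [x] can hang
    from either end, which adjusts the parity. *)
Lemma odd_tree_of_nonadjacent_private_nbrs a1 a2 x b1 b2 :
  dominating_pair a1 a2 -> adj G a1 x -> adj G a2 x ->
  adj G a1 b1 -> ~~ adj G a2 b1 -> adj G a2 b2 -> ~~ adj G a1 b2 ->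
  ~~ adj G b1 b2 -> has_odd_spanning_tree (compl G).
Proof.
move=> dom a1x a2x a1b1 na2b1 a2b2 na1b2 nb12.
have b12 : b1 != b2 := neq_nbr a1b1 na1b2.
have na12 : ~~ adj G a1 a2 by apply: tfG a1x _; rewrite adj_sym.
have nI a : ~~ adj G a a by rewrite adj_irrefl.
pose S0 := a2 |: (b2 |: [set y | adj G a1 y && ~~ adj G a2 y]).
have [S [sS0S sSS0 evS]] : exists S : {set V},
    [/\ {subset S0 <= S}, {subset S <= x |: S0} & ~~ odd #|S|].
  have xS0 : x \notin S0.
    rewrite !inE !negb_or a1x a2x /= andbT.
    by rewrite (neq_nbr a2x) // (neq_nbr a1x).
  case oS0: (odd #|S0|); last first.
    by exists S0; split=> //; [move=> z zS; rewrite inE zS orbT|rewrite oS0].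
  exists (x |: S0); split=> //; first by move=> z zS; rewrite inE zS orbT.
  by rewrite cardsU1 xS0 /= oS0.
have tS : odd_tree_on (compl G) S.
  apply: (odd_tree_on_star (x := b1)) => //.
    by apply: sS0S; rewrite !inE a1b1 na2b1 !orbT.
  move=> y /setD1P[yb1 /sSS0]; rewrite eq_sym in yb1.
  case/setU1P=> [E|/setU1P[E|/setU1P[E|]]].
  - by rewrite E in yb1 *; apply: (@compl_common_nbr a1).
  - by rewrite E in yb1 *; rewrite /= /compl_adj yb1 adj_sym.
  - by rewrite E in yb1 *; rewrite /= /compl_adj yb1.
  - by rewrite inE => /andP[a1y _]; apply: (@compl_common_nbr a1).
apply: (odd_tree_on_complete (x := b2) evV tS).
  by apply: sS0S; rewrite !inE eqxx orbT.
move=> y yS; have : y \notin S0 by apply: contra yS => /sS0S.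
rewrite !inE !negb_or negb_and negbK => /and3P[ya2 yb2 yC].
have [->|ya1] := eqVneq y a1.
  by rewrite /= /compl_adj adj_sym na1b2 (neq_nbr a2b2) // adj_sym.
apply: (@compl_common_nbr a2) => //; first by rewrite eq_sym.
by move: (dom y ya1 ya2) yC; case: (adj G a1 y).
Qed.

(** In the complement a common neighbour is adjacent to every other vertex except [a1] and [a2]. So
    [c2] is the centre of a star avoiding [c1], [c3], [a1], [a2]; then [b1] takes [c1] and [a2], and
    [b2] takes [c3] and [a1]. *)
Lemma odd_tree_of_three_common_nbrs a1 a2 c1 c2 c3 b1 b2 :
  dominating_pair a1 a2 -> uniq [:: c1; c2; c3] ->
  (forall c, c \in [:: c1; c2; c3] -> adj G a1 c && adj G a2 c) ->
  adj G a1 b1 -> ~~ adj G a2 b1 -> adj G a2 b2 -> ~~ adj G a1 b2 ->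
  has_odd_spanning_tree (compl G).
Proof.
move=> dom; rewrite /= !inE negb_or andbT => /andP[/andP[c12 c13] c23] Cadj.
move=> a1b1 na2b1 a2b2 na1b2.
have [a1c1 a2c1] := andP (Cadj c1 (mem_head _ _)).
have [|a1c2 a2c2] := andP (Cadj c2 _); first by rewrite !inE eqxx orbT.
have [|a1c3 a2c3] := andP (Cadj c3 _); first by rewrite !inE eqxx !orbT.
have na12 : ~~ adj G a1 a2 by apply: tfG a1c1 _; rewrite adj_sym.
have na21 : ~~ adj G a2 a1 by rewrite adj_sym.
have nI a : ~~ adj G a a by rewrite adj_irrefl.
have a12 : a1 != a2 by apply: contraNneq na2b1 => <-.
apply: (@star_two_cherries_odd_tree _ _ c2 b1 b2 c1 a2 c3 a1) => //.
- rewrite /= !inE !negb_or c13 !andbT.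
  by rewrite (neq_nbr a1c1 na12) (neq_nbr a1c1 (nI _)) [a2 == c3]eq_sym
    (neq_nbr a1c3 na12) [a2 == a1]eq_sym a12 (neq_nbr a1c3 (nI _)).
- rewrite !inE !negb_or c23 [c2 == c1]eq_sym c12.
  by rewrite (neq_nbr a1c2 na12) (neq_nbr a1c2 (nI _)).
- move=> y; rewrite !inE !negb_or => /and5P[yc2 _ ya2 _ ya1].
  by have /orP[ay|ay] := dom y ya1 ya2; [apply: (@compl_common_nbr a1)|
    apply: (@compl_common_nbr a2)]; rewrite // eq_sym.
- rewrite !inE !negb_or ![b1 == _]eq_sym (neq_nbr a2c1) // (neq_nbr a2c3) //.
  by rewrite ![_ == b1]eq_sym (neq_nbr a1b1 na12) (neq_nbr a1b1).
- by apply: (@compl_common_nbr a1) => //; rewrite eq_sym (neq_nbr a2c1).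
- by rewrite /= /compl_adj (neq_nbr a1b1 na12) adj_sym.
- by rewrite !inE !negb_or eq_sym (neq_nbr a1c3) //= (neq_nbr a2b2).
- by apply: (@compl_common_nbr a2) => //; rewrite eq_sym (neq_nbr a1c3).
- by rewrite /= /compl_adj (neq_nbr a2b2 na21) adj_sym.
Qed.

(** The star at [x] avoids [y], [a1], [a2], [b']; then [b] takes [y] and [a1], and the new vertex
    [a1] takes [a2] and [b']. *)
Lemma odd_tree_of_two_private_nbrs a1 a2 x b b' y :
  dominating_pair a1 a2 -> uniq [:: x; b; b'; y] -> adj G a1 x -> adj G a2 x ->
  adj G a2 b -> ~~ adj G a1 b -> adj G a2 b' -> ~~ adj G a1 b' -> adj G a2 y ->
  has_odd_spanning_tree (compl G).
Proof.
move=> dom; rewrite /= !inE !negb_or andbT.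
case/and3P=> /and3P[xb xb' xy] /andP[bb' b'y] b'y' a1x a2x a2b na1b a2b' na1b' a2y.
have na12 : ~~ adj G a1 a2 by apply: tfG a1x _; rewrite adj_sym.
have na21 : ~~ adj G a2 a1 by rewrite adj_sym.
have nI a : ~~ adj G a a by rewrite adj_irrefl.
have a12 : a1 != a2 by apply: contraNneq na1b => ->.
apply: (@star_two_cherries_odd_tree _ _ x b a1 y a1 a2 b') => //.
- rewrite /= !inE !negb_or a12 [y == b']eq_sym b'y' !andbT /=.
  by rewrite (neq_nbr a2y na21) (neq_nbr a2y (nI _)) ![_ == b']eq_sym
    (neq_nbr a2b' na21) (neq_nbr a2b' (nI _)).
- by rewrite !inE !negb_or xy xb' (neq_nbr a2x na21) (neq_nbr a2x (nI _)).
- move=> z; rewrite !inE !negb_or => /and5P[zx _ za1 za2 _].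
  by have /orP[az|az] := dom z za1 za2; [apply: (@compl_common_nbr a1)|
    apply: (@compl_common_nbr a2)]; rewrite // eq_sym.
- by rewrite !inE !negb_or b'y bb' (neq_nbr a2b na21) (neq_nbr a2b (nI _)).
- exact: (@compl_common_nbr a2).
- by rewrite /= /compl_adj (neq_nbr a2b na21) adj_sym.
- by rewrite !inE !negb_or a12 eq_sym (neq_nbr a2b' na21).
- by rewrite /= /compl_adj a12.
- by rewrite /= /compl_adj eq_sym (neq_nbr a2b' na21).
Qed.

Definition common_nbrs a1 a2 := [set y | adj G a1 y && adj G a2 y].
Definition private_nbrs a1 a2 := [set y | adj G a1 y && ~~ adj G a2 y].

Lemma common_nbrs_sym a1 a2 : common_nbrs a1 a2 = common_nbrs a2 a1.
Proof. by apply/setP=> y; rewrite !inE andbC. Qed.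

(** The two cardinals add up to the degree of [a2], so the last bound provides a neighbour [y] of
    [a2] besides [x], [b] and [b']. *)
Lemma odd_tree_of_card_private a1 a2 : dominating_pair a1 a2 ->
  0 < #|common_nbrs a1 a2| -> 1 < #|private_nbrs a2 a1| ->
  3 < #|common_nbrs a1 a2| + #|private_nbrs a2 a1| ->
  has_odd_spanning_tree (compl G).
Proof.
move=> dom /card_gt0P[x]; rewrite inE => /andP[a1x a2x].
case/card_gt1P=> b [b' []]; rewrite !inE => /andP[a2b na1b] /andP[a2b' na1b'] bb' c4.
have : ~~ ([set y | adj G a2 y] \subset [set x; b; b']).
  apply/negP=> /subset_leq_card; rewrite leqNgt => /negP[].
  have -> : #|[set y | adj G a2 y]| = #|common_nbrs a1 a2| + #|private_nbrs a2 a1|.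
    rewrite -(cardsID [set y | adj G a1 y]).
    by congr (_ + _); apply: eq_card => y; rewrite !inE andbC.
  by apply: leq_ltn_trans c4; rewrite -setUA cardsU1 cards2; case: (_ \notin _); case: (_ != _).
case/subsetPn=> y; rewrite !inE !negb_or => a2y /andP[/andP[yx yb] yb'].
apply: (@odd_tree_of_two_private_nbrs a1 a2 x b b' y) => //.
rewrite /= !inE !negb_or bb' ![_ == y]eq_sym yx yb yb' !andbT /=.
by rewrite (neq_nbr a1x) // (neq_nbr a1x).
Qed.

(** The 5-cycle is [b], [b1], [a1], [x], [a2], and [b'] doubles [b]. *)
Lemma C5_2_of_two_private_nbrs a1 a2 x b1 b b' : #|V| = 6 ->
  adj G a1 x -> adj G a2 x -> adj G a1 b1 ->
  adj G a2 b -> adj G a2 b' -> b != b' -> adj G b1 b -> adj G b1 b' ->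
  isomorphic G (C5_blowup 2).
Proof.
move=> cV a1x a2x a1b1 a2b a2b' bb' b1b b1b'.
by apply: (@C5_2_isomorphic _ _ b b' b1 a1 x a2) => //; rewrite adj_sym.
Qed.

Lemma odd_tree_or_C5_2 a1 a2 : dominating_pair a1 a2 ->
  0 < #|common_nbrs a1 a2| -> 0 < #|private_nbrs a1 a2| ->
  0 < #|private_nbrs a2 a1| ->
  has_odd_spanning_tree (compl G) \/ isomorphic G (C5_blowup 2).
Proof.
move=> dom c0 p0 q0; have dom' := dominating_pair_sym dom.
have [/existsP[[b1 b2] /and3P[]]|/existsPn cmpl] := boolP [exists e : V * V,
    [&& e.1 \in private_nbrs a1 a2, e.2 \in private_nbrs a2 a1 & ~~ adj G e.1 e.2]].
  rewrite !inE /= => /andP[a1b1 na2b1] /andP[a2b2 na1b2] nb12; left.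
  have [x] := card_gt0P c0; rewrite inE => /andP[a1x a2x].
  exact: (@odd_tree_of_nonadjacent_private_nbrs a1 a2 x b1 b2).
have adjB b1 b2 : b1 \in private_nbrs a1 a2 -> b2 \in private_nbrs a2 a1 -> adj G b1 b2.
  by move=> b1P b2P; move: (cmpl (b1, b2)); rewrite b1P b2P negbK.
have [c3|c2] := ltnP 2 #|common_nbrs a1 a2|.
  have [c1 [c [c' [[C1 C2 C3] [c12 c23 c31]]]]] := card_gt2P c3.
  have [b1] := card_gt0P p0; have [b2] := card_gt0P q0.
  rewrite !inE => /andP[a2b2 na1b2] /andP[a1b1 na2b1]; left.
  apply: (@odd_tree_of_three_common_nbrs a1 a2 c1 c c' b1 b2) => //.
    by rewrite /= !inE negb_or c12 c23 eq_sym c31.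
  by move=> z; rewrite !inE => /or3P[]/eqP->; [move: C1|move: C2|move: C3]; rewrite inE.
have [/andP[q2 q4]|q'] := boolP ((1 < #|private_nbrs a2 a1|) &&
    (3 < #|common_nbrs a1 a2| + #|private_nbrs a2 a1|)).
  by left; apply: (@odd_tree_of_card_private a1 a2).
have [/andP[p2 p4]|p'] := boolP ((1 < #|private_nbrs a1 a2|) &&
    (3 < #|common_nbrs a1 a2| + #|private_nbrs a1 a2|)).
  by left; apply: (@odd_tree_of_card_private a2 a1); rewrite // common_nbrs_sym.
right; have [x] := card_gt0P c0; have [b1 b1P] := card_gt0P p0.
have [b2 b2P] := card_gt0P q0; rewrite inE => /andP[a1x a2x].
have [/andP[a1b1 na2b1] /andP[a2b2 na1b2]] :
  adj G a1 b1 && ~~ adj G a2 b1 /\ adj G a2 b2 && ~~ adj G a1 b2.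
  by move: b1P b2P; rewrite !inE.
have na12 : ~~ adj G a1 a2 by apply: tfG a1x _; rewrite adj_sym.
have cV : #|V| = #|common_nbrs a1 a2| + #|private_nbrs a1 a2|
                 + #|private_nbrs a2 a1| + 2.
  have a12 : a1 != a2 by apply: contraNneq na2b1 => <-.
  have <- : #|[set a1; a2]| = 2 by rewrite cards2 a12.
  rewrite -(cardsC [set a1; a2]) addnC; congr (_ + _).
  rewrite -(cardsID [set y | adj G a1 y]) -(cardsID [set y | adj G a2 y] (_ :&: _)).
  congr (_ + _ + _); apply: eq_card => y; rewrite !inE negb_or.
  - have [->|_] := eqVneq y a1; first by rewrite adj_irrefl.
    by have [->|_] := eqVneq y a2; rewrite ?(negbTE na12).
  - have [->|_] := eqVneq y a1; first by rewrite adj_irrefl /= andbF.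
    by have [->|_] := eqVneq y a2; rewrite ?(negbTE na12) ?andbF //= andbC.
  - have [->|y1] := eqVneq y a1; first by rewrite adj_sym (negbTE na12) adj_irrefl.
    have [->|y2] := eqVneq y a2; first by rewrite adj_irrefl !andbF.
    by move: (dom y y1 y2); case: (adj G a1 y); case: (adj G a2 y).
(* Two common neighbours now force one private neighbour on each side, and a single one allows at
   most two on each side. Even order leaves three triples, all with [#|V| = 6]. *)
have /or3P[/and3P[/eqP Ec /eqP Ep /eqP Eq]|/and3P[/eqP Ec /eqP Ep /eqP Eq]|
    /and3P[/eqP Ec /eqP Ep /eqP Eq]] :
  [|| [&& #|common_nbrs a1 a2| == 2, #|private_nbrs a1 a2| == 1 & #|private_nbrs a2 a1| == 1],
      [&& #|common_nbrs a1 a2| == 1, #|private_nbrs a1 a2| == 1 & #|private_nbrs a2 a1| == 2]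
    | [&& #|common_nbrs a1 a2| == 1, #|private_nbrs a1 a2| == 2 & #|private_nbrs a2 a1| == 1]].
- move: evV c0 p0 q0 c2 q' p'; rewrite cV; clear.
  move: #|common_nbrs _ _| #|private_nbrs a1 a2| #|private_nbrs a2 a1| => c p q.
  by case: c => [|[|[|c]]] //; case: p => [|[|[|p]]] //; case: q => [|[|[|q]]].
- rewrite Ec Ep Eq in cV.
  have /card_gt1P[c [c' []]] : 1 < #|common_nbrs a1 a2| by rewrite Ec.
  rewrite !inE => /andP[a1c a2c] /andP[a1c' a2c'] cc'.
  apply: (@C5_2_isomorphic _ _ c c' a1 b1 b2 a2) => //;
    by [exact: adjB|rewrite adj_sym].
- rewrite Ec Ep Eq in cV.
  have /card_gt1P[b [b' [bP b'P bb']]] : 1 < #|private_nbrs a2 a1| by rewrite Eq.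
  apply: (@C5_2_of_two_private_nbrs a1 a2 x b1 b b') => //; try exact: adjB.
  + by move: bP; rewrite inE => /andP[].
  + by move: b'P; rewrite inE => /andP[].
- rewrite Ec Ep Eq in cV.
  have /card_gt1P[b [b' [bP b'P bb']]] : 1 < #|private_nbrs a1 a2| by rewrite Ep.
  apply: (@C5_2_of_two_private_nbrs a2 a1 x b2 b b') => //.
  + by move: bP; rewrite inE => /andP[].
  + by move: b'P; rewrite inE => /andP[].
  + by rewrite adj_sym; apply: adjB.
  + by rewrite adj_sym; apply: adjB.
Qed.

(** * Case analysis at a vertex of even degree *)

Lemma odd_tree_or_exceptional : ~~ odd_graph G ->
  [\/ has_odd_spanning_tree (compl G), isomorphic G (C5_blowup 2)
   | exists s t, [/\ 0 < s, 0 < t & isomorphic G (Kmn (2 * s) (2 * t)) \/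
                                    isomorphic_del_edge G (Kmn (2 * s) (2 * t))]].
Proof.
case/forallPn=> x evA; pose A := [set y | adj G x y].
have xA : x \notin A by rewrite inE adj_irrefl.
have evA' : ~~ odd #|A| by [].
have evB : ~~ odd #|~: A| by rewrite odd_cardsC.
have starB : {in ~: A :\ x, forall y, adj (compl G) x y}.
  by move=> y; rewrite !inE => /andP[yx nxy]; rewrite /= /compl_adj eq_sym yx.
(* If [A] is empty, the star at [x] spans the complement. *)
have [A0|[a0 a0A]] := set_0Vmem A.
  apply: Or31; apply: odd_tree_onT; apply: (odd_tree_on_star (x := x)).
  - by rewrite inE.
  - by rewrite cardsT.
  - by move=> y; rewrite -[setT]setC0 -A0; apply: starB.
have indA : {in A &, forall u v, ~~ adj G u v}.
  by move=> u v; rewrite !inE => xu xv; apply: tfG xv; rewrite adj_sym.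
have [/existsP[b /existsP[a1 /existsP[a2 /and5P[bA a1A a2A a12 /andP[n1 n2]]]]]|noB] :=
  boolP [exists b, [exists a1, [exists a2, [&& b \notin A, a1 \in A, a2 \in A,
    a1 != a2 & ~~ adj G b a1 && ~~ adj G b a2]]]].
  have neqA w : w \in A -> b != w by move=> wA; apply: contraNneq bA => ->.
  apply: Or31.
  apply: (@two_stars_odd_tree _ _ (~: A) x b a1 a2) => //.
  - by rewrite inE.
  - by rewrite inE.
  - by rewrite inE negbK.
  - by rewrite inE negbK.
  - by rewrite /= /compl_adj neqA.
  - by rewrite /= /compl_adj neqA.
  - move=> y; rewrite inE negbK => yA _ ya2.
    by rewrite /= /compl_adj eq_sym ya2 indA.
have miss b : b \notin A ->
    {in A &, forall a a', ~~ adj G b a -> ~~ adj G b a' -> a = a'}.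
  move=> bA a a' aA a'A n n'; apply/eqP; apply: contraNT noB => aa'.
  apply/existsP; exists b; apply/existsP; exists a; apply/existsP; exists a'.
  by rewrite bA aA a'A aa' n n'.
have [/existsP[u /existsP[v /and3P[uA vA uv]]]|indB] :=
  boolP [exists u, [exists v, [&& u \notin A, v \notin A & adj G u v]]]; last first.
  have ind : {in ~: A &, forall u v, ~~ adj G u v}.
    move=> u v; rewrite !in_setC => uA vA; apply: contra indB => uv.
    by apply/existsP; exists u; apply/existsP; exists v; rewrite uA vA.
  have xad : {in A, forall a, adj G x a} by move=> a; rewrite inE.
  have half n : ~~ odd n -> n = 2 * n./2 by move=> /even_halfK; rewrite mul2n.
  have half0 n : 0 < n -> ~~ odd n -> 0 < n./2 by case: n => [|[|n]].
  have [t|i|i] := near_complete_bipartite evV evA' a0A indA ind xA xad miss.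
  - exact: Or31.
  - apply: Or33; exists #|A|./2, #|~: A|./2; rewrite -!half //; split.
    + by apply: half0 => //; apply/card_gt0P; exists a0.
    + by apply: half0 => //; apply/card_gt0P; exists x; rewrite inE.
    + by left.
  - apply: Or33; exists #|A|./2, #|~: A|./2; rewrite -!half //; split.
    + by apply: half0 => //; apply/card_gt0P; exists a0.
    + by apply: half0 => //; apply/card_gt0P; exists x; rewrite inE.
    + by right.
have /card_gt1P[a1 [a2 [a1A a2A a12]]] : 1 < #|A|.
  have : 0 < #|A| by apply/card_gt0P; exists a0.
  by move: evA'; case: #|A| => [|[|n]].
(* [u] and [v] have no common neighbour, so each element of [A] is missed by
   one of them. *)
have missed w : w \in A -> ~~ adj G u w || ~~ adj G v w.
  move=> wA; rewrite -negb_and; apply/negP=> /andP[uw vw].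
  by move: (tfG uv vw); rewrite uw.
(* Each of [u] and [v] misses at most one vertex of [A], so two vertices of [A] must be missed by
   different ends. *)
have [c1 [c2 [c1A c2A nuc1 nvc2 c12]]] : exists c1 c2,
    [/\ c1 \in A, c2 \in A, ~~ adj G u c1, ~~ adj G v c2 & c1 != c2].
  have /orP[n1|n1] := missed _ a1A; have /orP[n2|n2] := missed _ a2A.
  - by case/eqP: a12; apply: (miss u).
  - by exists a1, a2.
  - by exists a2, a1; rewrite eq_sym.
  - by case/eqP: a12; apply: (miss v).
have Ac w : w \in A -> w = c1 \/ w = c2.
  by move=> wA; have /orP[n|n] := missed _ wA;
    [left; apply: (miss u)|right; apply: (miss v)].
have uc2 : adj G u c2.
  by apply/negPn; apply: contra c12 => n; apply/eqP; apply: (miss u).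
have vc1 : adj G v c1.
  by apply/negPn; apply: contra c12 => n; apply/eqP; apply: (miss v).
(* Now [A] consists of [c1] and [c2], which dominate by [miss]; [x] is a common neighbour, [v] is
   private to [c1] and [u] to [c2]. *)
have [||||t|i] := @odd_tree_or_C5_2 c1 c2.
- move=> w w1 w2; have [wA|wA] := boolP (w \in A).
    by case: (Ac w wA) => E; [rewrite E eqxx in w1|rewrite E eqxx in w2].
  rewrite ![adj G _ w]adj_sym; apply: contraNT c12; rewrite negb_or => /andP[n1 n2].
  by apply/eqP; apply: (miss w).
- by apply/card_gt0P; exists x; rewrite !inE in c1A c2A *; rewrite ![adj G _ x]adj_sym c1A.
- by apply/card_gt0P; exists v; rewrite !inE adj_sym vc1 adj_sym.
- by apply/card_gt0P; exists u; rewrite !inE adj_sym uc2 adj_sym.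
- exact: Or31.
- exact: Or32.
Qed.

End TwoDominatingVertices.

Theorem theorem4p3 (V : finType) (G : sgraph V) :
  triangle_free G ->
  ~~ odd #|V| ->
  ~~ odd_graph G ->
  has_odd_spanning_tree (compl G) <->
  ~ isomorphic G (C5_blowup 2) /\
  (forall s t : nat, 0 < s -> 0 < t ->
     ~ isomorphic G (Kmn (2 * s) (2 * t)) /\
     ~ isomorphic_del_edge G (Kmn (2 * s) (2 * t))).
Proof.
move=> tfG evV nodd; split=> [ost|[nC5 nK]].
  split; first by move/C5_blowup2_no_odd_spanning_tree.
  move=> s t s0 t0; split; first by move/(Kmn_no_odd_spanning_tree s0 t0).
  by move/(Kmn_del_edge_no_odd_spanning_tree s0 t0).
have [//|//|[s [t [s0 t0 iso]]]] := odd_tree_or_exceptional tfG evV nodd.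
by have [nK1 nK2] := nK s t s0 t0; case: iso.
Qed.
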